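(* Let $X\subseteq[0,\infty)^k$ be an infinite discrete additive semigroup with $0\in X$, and let $\mathscr{A}=\mathbb{C}^X$ be its Dirichlet algebra. For $d\in\mathbb{N}$ and $a_0,\ldots,a_d\in\mathscr{A}$ with $a_d\neq 0$, put $$Tg=a_d*g^{*d}+a_{d-1}*g^{*(d-1)}+\cdots+a_1*g+a_0\qquad(g\in\mathscr{A})$$ and $$f(z)=a_d(0)z^d+a_{d-1}(0)z^{d-1}+\cdots+a_1(0)z+a_0(0)\in\mathbb{C}[z].$$ Then: (i) If $z_0\in\mathbb{C}$ is a simple zero of $f(z)$, then there exists a uniquely determined $g\in\mathscr{A}$ with $Tg=0$ and $g(0)=z_0$. (ii) If $f(z)$ has no simple zeros, then $Tg=0$ need not possess any solution; that is, there exist $d\in\mathbb{N}$ and $a_0,\ldots,a_d\in\mathscr{A}$ with $a_d\ne 0$ such that the associated polynomial $f(z)$ has no simple zeros and $Tg=0$ has no solution $g\in\mathscr{A}$. (iii) In any case (for every $d\in\mathbb{N}$ and all $a_0,\ldots,a_d\in\mathscr{A}$ with $a_d\neq0$), $Tg=0$ has at most $d$ solutions $g\in\mathscr{A}$.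
   Context: Here $k\in\mathbb{N}=\{1,2,\ldots\}$. $X$ is a subset of $[0,\infty)^k$ closed under addition; ''discrete'' means $X$ has no cluster point in $\mathbb{R}^k$ (so $X$ is countable). The Dirichlet algebra $\mathscr{A}=\mathscr{A}(X)=\mathbb{C}^X$ is the commutative complex algebra of all functions $g\colon X\to\mathbb{C}$ with the usual linear operations and multiplication given by convolution $$(g*h)(x)=\sum_{x',x''\in X,\ x'+x''=x}g(x')h(x'')\qquad(x\in X)$$ (a finite sum). Its unit element is $u$ with $u(0)=1$ and $u(x)=0$ for $x\neq0$. $g^{*j}$ denotes the $j$-fold convolution $g*\cdots*g$, with $g^{*0}=u$. *)

(* Defs.v *)
From HB Require Import structures.
From mathcomp Require Import all_boot all_order all_algebra.
From mathcomp Require Import all_classical all_reals all_analysis.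
From mathcomp Require Import complex.

Set Implicit Arguments.
Unset Strict Implicit.
Unset Printing Implicit Defensive.

Import Order.TTheory GRing.Theory Num.Theory.
Import numFieldNormedType.Exports.

Local Open Scope classical_set_scope.
Local Open Scope ring_scope.
Local Open Scope complex_scope.

Section DirichletAlgebra.
Context {R : realType} {k : nat}.
Implicit Types X : set 'rV[R]_k.

(* [X] is coerced to the type [{x | x \in X}] of its elements. *)
Definition dirichlet X : Type := X -> R[i].

(* [\sum_(p \in A)] is the sum over the classical set [A]; it would be 0 if the
   summand had infinite support on [A].  For a discrete [X] in the nonnegative
   orthant the index set below is finite, so this convention plays no role. *)
Definition dconv X (g h : dirichlet X) : dirichlet X := fun x =>
  \sum_(p \in [set p : X * X | val p.1 + val p.2 = val x]) (g p.1 * h p.2).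

Definition dunit X : dirichlet X := fun x => (val x == 0)%:R.
Arguments dunit : clear implicits.

Definition dpow X (g : dirichlet X) (j : nat) : dirichlet X :=
  iter j (dconv g) (dunit X).

Definition dzero X : dirichlet X := fun=> 0.

Definition at0 X (X0 : X 0) (g : dirichlet X) : R[i] :=
  g (exist (fun x => x \in X) 0 (mem_set X0)).

Definition dpoly X d (a : 'I_d.+1 -> dirichlet X) (g : dirichlet X) :
    dirichlet X :=
  fun x => \sum_(j < d.+1) dconv (a j) (dpow g j) x.

Definition poly_at0 X (X0 : X 0) d (a : 'I_d.+1 -> dirichlet X) :
    {poly R[i]} :=
  \sum_(j < d.+1) at0 X0 (a j) *: 'X^j.

End DirichletAlgebra.

Arguments dunit {R k} X.
Arguments dzero {R k} X.

(* For [f = 0] the library sets [mup z f = 0], so that the zero polynomial has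
   no simple zeros, as it should. *)
Definition simple_zero {F : fieldType} (f : {poly F}) (z : F) : Prop :=
  mup z f = 1%N.

(* Main.v *)
Require Import Defs.
From HB Require Import structures.
From mathcomp Require Import all_boot all_order all_algebra.
From mathcomp Require Import all_classical all_reals all_analysis.
From mathcomp Require Import finmap complex.

Set Implicit Arguments.
Unset Strict Implicit.
Unset Printing Implicit Defensive.

Import Order.TTheory GRing.Theory Num.Theory.
Import numFieldNormedType.Exports.

Local Open Scope classical_set_scope.
Local Open Scope card_scope.
Local Open Scope ring_scope.
Local Open Scope complex_scope.

(** Adding a translation-invariant total order of type omega to the semigroup
makes the Dirichlet algebra behave like a ring of formal power series in one
variable.  Such an order is recorded by an injective rank with values in the
natural numbers: a discrete [X] in the nonnegative orthant has one because its
elements of bounded coordinate sum are finite in number (Bolzano-Weierstrass),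
so that comparing first coordinate sums and then coordinates leaves only
finitely many predecessors ([position]).

With respect to the rank, the lowest terms of two functions multiply
([mul_lead]).  Two consequences carry the theorem.  First, the algebra is an
integral domain, hence a polynomial of degree at most [d] has at most [d] roots
in it, which is (iii).  Second, [g |-> g 0] is a ring morphism, and if [g] and
[h] have the same constant term [z0] and agree below [x], then
[P.[g] - P.[h]] at [x] equals [(g x - h x) * f'(z0)] ([horner_linearize]), where
[f] is the image of [P] under that morphism.  When [f'(z0)] is nonzero this is a
linear equation that determines [g x] from the values below [x]; solving it rank
by rank gives existence and uniqueness in (i).

For (ii), let [e] be the element of least positive rank.  It is not a sum of two
nonzero elements, so a function [g] with [g ^+ 2] the indicator of [e] would
have [g 0 = 0] and then [(g ^+ 2) e = 0]; thus [z ^ 2 = 0], with its double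
zero, has a lift without solutions. *)

(** * Semigroups with a rank *)

(** The rank stands for a total order of type at most omega, invariant under
translations and with least element [0]: injectivity is totality, and values in
[nat] give both well-foundedness and finite initial segments.  The last axiom
quantifies over [u] and [v] with prescribed values so as not to depend on how
membership of a sum in the carrier is proved. *)
Record ranked_semigroup (R : realType) (k : nat) := RankedSemigroup {
  carrier :> set 'rV[R]_k;
  carrier0 : carrier 0;
  carrierD : forall x y, carrier x -> carrier y -> carrier (x + y);
  rank : carrier -> nat;
  rank_inj : injective rank;
  rank0 : rank (exist (fun x => x \in carrier) 0 (mem_set carrier0)) = 0%N;
  rank_ltD2l : forall x y z u v : carrier,
    val u = val x + val y -> val v = val x + val z ->
    (rank y < rank z)%N -> (rank u < rank v)%N
}.

Section Semigroup.
Context {R : realType} {k : nat} (S : ranked_semigroup R k).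
Implicit Types x y z u v : S.

Definition szero : S :=
  exist (fun w => w \in carrier S) 0 (mem_set (carrier0 S)).

Definition sadd x y : S :=
  exist (fun w => w \in carrier S) (val x + val y)
    (mem_set (carrierD (set_valP x) (set_valP y))).

Lemma rank_ltDl x y z :
  (rank y < rank z)%N -> (rank (sadd x y) < rank (sadd x z))%N.
Proof. exact: rank_ltD2l. Qed.

Lemma saddC : commutative sadd.
Proof. by move=> x y; apply: val_inj; rewrite /= addrC. Qed.

Lemma saddA : associative sadd.
Proof. by move=> x y z; apply: val_inj; rewrite /= addrA. Qed.

Lemma sadd0 x : sadd x szero = x.
Proof. by apply: val_inj; rewrite /= addr0. Qed.

Lemma sadd_eq x y z : (val x + val y == val z) = (sadd x y == z).
Proof. by []. Qed.

Lemma rank_leDl x y z :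
  (rank y <= rank z)%N -> (rank (sadd x y) <= rank (sadd x z))%N.
Proof.
by rewrite leq_eqVlt => /predU1P[/rank_inj->//|/(rank_ltDl x)/ltnW].
Qed.

Lemma rank_saddl x y : (rank x <= rank (sadd x y))%N.
Proof.
by have := @rank_leDl x szero y; rewrite sadd0; apply; rewrite rank0.
Qed.

Lemma rank_saddr x y : (rank y <= rank (sadd x y))%N.
Proof. by rewrite saddC rank_saddl. Qed.

(** Strict monotonicity of addition: raising either summand raises the sum, so
a sum attaining its lower bound has both summands minimal. *)
Lemma sadd_lead a b x y :
  (rank a <= rank x)%N -> (rank b <= rank y)%N -> sadd x y = sadd a b ->
  x = a /\ y = b.
Proof.
move=> ax bY xy.
have key c d u v : (rank c <= rank u)%N -> (rank d <= rank v)%N ->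
    sadd u v = sadd c d -> u = c.
  move=> cu dv uv; apply: rank_inj; apply/eqP; rewrite eqn_leq cu andbT leqNgt.
  apply/negP => /(rank_ltDl v); rewrite [sadd v u]saddC uv [sadd v c]saddC.
  by rewrite ltnNge rank_leDl.
by split; [exact: key ax bY xy|apply: key bY ax _; rewrite saddC xy saddC].
Qed.

Lemma finite_rank_lt n : finite_set [set x : S | (rank x < n)%N].
Proof.
apply: (@finite_preimage _ _ `I_n) => //.
by move=> x y _ _; exact: rank_inj.
Qed.

Definition initial n : seq S :=
  finmap.enum_fset (fset_set [set x : S | (rank x < n)%N]).

Lemma mem_initial n x : (x \in initial n) = (rank x < n)%N.
Proof.
rewrite /initial in_fset_set; last exact: finite_rank_lt.
by apply/idP/idP => [/set_mem|]; last exact: mem_set.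
Qed.

Lemma initial_uniq n : uniq (initial n).
Proof. exact: finmap.fset_uniq. Qed.

End Semigroup.

(** * The Dirichlet algebra is an integral domain *)

Section Algebra.
Context {R : realType} {k : nat}.
Implicit Types S : ranked_semigroup R k.

Definition algebra S : Type := dirichlet S.
(* The name [algebra S] keeps the ring structure by convolution apart from the
   pointwise one that functions carry; only the additive group is shared. *)
HB.instance Definition _ S := Choice.copy (algebra S) (S -> R[i]).
HB.instance Definition _ S := GRing.Zmodule.copy (algebra S) (S -> R[i]).

Section Convolution.
Variable S : ranked_semigroup R k.
Implicit Types (f g h : algebra S) (x y z : S).

(** Both summands of [x] have rank at most that of [x], so a fixed initial
segment can serve as index set for every [x] in it.  This turns the ring axioms
into exchanges of finite sums. *)
Lemma dconvE n g h x : (rank x < n)%N ->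
  dconv g h x = \sum_(y <- initial S n) \sum_(z <- initial S n)
                  (g y * h z) *+ (sadd y z == x).
Proof.
move=> xn; rewrite /dconv.
rewrite (@fsbigE _ _ _ _ _
  [seq p <- [seq (y, z) | y <- initial S n, z <- initial S n]
     | sadd p.1 p.2 == x]); first last.
- move=> [y z] /= yzx; rewrite mem_filter /= -sadd_eq yzx eqxx /=.
  have yz : sadd y z = x by apply: val_inj.
  rewrite allpairs_f ?mem_initial//; rewrite (leq_ltn_trans _ xn)// -yz.
    exact: rank_saddl.
  exact: rank_saddr.
- by move=> p /=; rewrite mem_filter => /andP[/eqP <-].
- apply: filter_uniq; apply: allpairs_uniq; rewrite ?initial_uniq//.
  by move=> [] ? ? [] ? ? _ _ [-> ->].
rewrite big_filter_cond big_mkcond big_allpairs.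
apply: eq_bigr => y _; apply: eq_bigr => z _; rewrite mulrb /= -sadd_eq.
case: eqP => [yz|//]; by rewrite mem_set.
Qed.

Lemma sum_mulrb_eq (V : zmodType) (s : seq S) a (F : S -> V) : uniq s ->
  \sum_(z <- s) F z *+ (z == a) = F a *+ (a \in s).
Proof.
move=> us; case: (boolP (a \in s)) => as_.
  rewrite (bigD1_seq a)//= eqxx big1 ?addr0// => z /negPf ->.
  by rewrite mulr0n.
rewrite big_seq big1// => z zs; case: eqP => [za|//].
by rewrite -za zs in as_.
Qed.

(** The right-hand side treats [y], [u] and [v] alike up to associativity of
the semigroup, which is what makes convolution associative. *)
Lemma dconv_convE n f g h x : (rank x < n)%N ->
  dconv f (dconv g h) x =
  \sum_(y <- initial S n) \sum_(u <- initial S n) \sum_(v <- initial S n)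
    (f y * (g u * h v)) *+ (sadd y (sadd u v) == x).
Proof.
move=> xn; rewrite (dconvE _ _ xn); apply: eq_bigr => y _.
(* The intermediate point [z = u + v] is summed out last; it lies in the initial
   segment as soon as [y + z = x]. *)
transitivity (\sum_(z <- initial S n)
   \sum_(u <- initial S n) \sum_(v <- initial S n)
    ((f y * (g u * h v)) *+ (sadd y z == x)) *+ (z == sadd u v)).
  rewrite big_seq [RHS]big_seq; apply: eq_bigr => z.
  rewrite mem_initial => zn; rewrite (dconvE _ _ zn) mulr_sumr -sumrMnl.
  apply: eq_bigr => u _; rewrite mulr_sumr -sumrMnl.
  apply: eq_bigr => v _.
  by rewrite mulrnAr [_ == z]eq_sym -!mulrnA mulnC.
rewrite exchange_big; apply: eq_bigr => u _.
rewrite exchange_big; apply: eq_bigr => v _.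
rewrite sum_mulrb_eq ?initial_uniq// mem_initial.
case: eqP => [yx|]; last by rewrite mul0rn.
by rewrite (leq_ltn_trans _ xn) -?yx ?rank_saddr.
Qed.

Lemma dconvC : commutative (fun g h : algebra S => dconv g h : algebra S).
Proof.
move=> g h; apply/funext => x; rewrite !(dconvE _ _ (ltnSn _)) exchange_big.
by do 2![apply: eq_bigr => ? _]; rewrite mulrC saddC.
Qed.

Lemma dconvA : associative (fun g h : algebra S => dconv g h : algebra S).
Proof.
move=> f g h; rewrite [RHS]dconvC; apply/funext => x.
rewrite !(dconv_convE _ _ _ (ltnSn _)).
rewrite [RHS]exchange_big; apply: eq_bigr => y _.
rewrite [RHS]exchange_big; apply: eq_bigr => u _; apply: eq_bigr => v _.
by rewrite mulrA mulrC saddA saddC.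
Qed.

Lemma dunitE x : dunit S x = (x == szero S)%:R.
Proof. by []. Qed.

Lemma dconv1l : left_id (dunit S : algebra S)
  (fun g h : algebra S => dconv g h : algebra S).
Proof.
move=> g; apply/funext => x; rewrite (dconvE _ _ (ltnSn _)) exchange_big.
transitivity (\sum_(z <- initial S (rank x).+1) g z *+ (z == x)).
  apply: eq_bigr => z _.
  transitivity (\sum_(y <- initial S (rank x).+1)
     g z *+ (sadd y z == x) *+ (y == szero S)).
    by apply: eq_bigr => y _; rewrite dunitE mulr_natl -!mulrnA mulnC.
  rewrite sum_mulrb_eq ?initial_uniq// mem_initial rank0 saddC sadd0.
  by rewrite mulr1n.
by rewrite sum_mulrb_eq ?initial_uniq// mem_initial ltnSn.
Qed.

Lemma dconvDl : left_distributive
  (fun g h : algebra S => dconv g h : algebra S) +%R.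
Proof.
move=> f g h; apply/funext => x.
transitivity (dconv f h x + dconv g h x); last by [].
rewrite !(dconvE _ _ (ltnSn _)) -big_split; apply: eq_bigr => y _.
rewrite -big_split; apply: eq_bigr => z _.
by rewrite /= -mulrnDl -mulrDl.
Qed.

Lemma dunit_neq0 : (dunit S : algebra S) != 0.
Proof.
by apply/eqP => /(congr1 (@^~ (szero S)))/eqP; rewrite dunitE eqxx oner_eq0.
Qed.

End Convolution.

HB.instance Definition _ S := GRing.Zmodule_isComNzRing.Build (algebra S)
  (@dconvA S) (@dconvC S) (@dconv1l S) (@dconvDl S) (@dunit_neq0 S).

Section LeadingTerms.
Variable S : ranked_semigroup R k.
Implicit Types (g h : algebra S) (a b x y z : S).

(** If [y + z = a + b] with [(y, z)] other than [(a, b)], then [y] lies below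
[a] or [z] lies below [b], so only one summand of the convolution survives. *)
Lemma mul_lead g h a b :
  (forall y, (rank y < rank a)%N -> g y = 0) ->
  (forall y, (rank y < rank b)%N -> h y = 0) ->
  (g * h) (sadd a b) = g a * h b.
Proof.
move=> ga hb; rewrite -[LHS]/(dconv g h (sadd a b)) /dconv.
rewrite -(@fsbig_widen _ _ _ _ [set (a, b)]).
- by rewrite fsbig_set1.
- by move=> p /= ->.
- move=> [y z] /= [yz yzab].
  have [ya|ay] := ltnP (rank y) (rank a); first by rewrite ga// mul0r.
  have [zb|bz] := ltnP (rank z) (rank b); first by rewrite hb// mulr0.
  have [yE zE] : y = a /\ z = b by apply: sadd_lead => //; exact: val_inj.
  by case: yzab; rewrite yE zE.
Qed.

Lemma lead_exists g : g != 0 ->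
  exists2 a, g a != 0 & forall y, (rank y < rank a)%N -> g y = 0.
Proof.
move=> g0.
have /ex_minnP[n /asboolP[a an ga] nmin] :
    exists n, `[< exists2 a, rank a = n & g a != 0 >].
  apply: contrapT => gn; move/eqP: g0; apply; apply/funext => a.
  apply: contrapT => /eqP ga; apply: gn; exists (rank a).
  by apply/asboolP; exists a.
exists a => // y ya; apply: contrapT => /eqP gy.
by move: ya; rewrite an ltnNge nmin//; apply/asboolP; exists y.
Qed.

Lemma algebra_mulf_eq0 g h : g * h = 0 -> (g == 0) || (h == 0).
Proof.
move=> gh; apply: contrapT => /negP; rewrite negb_or.
move=> /andP[/lead_exists[a ga la] /lead_exists[b hb lb]].
have /eqP := mul_lead la lb; rewrite gh eq_sym mulf_eq0.
by rewrite (negPf ga) (negPf hb).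
Qed.

(** Invertibility is decided classically; it only serves to complete the
integral domain structure on which the bound for the number of roots rests. *)
Definition algebra_unit : {pred algebra S} :=
  [pred g | `[< exists h, h * g = 1 >]].

Definition algebra_inv g : algebra S :=
  if pselect (exists h, h * g = 1) is left e then projT1 (cid e) else g.

Lemma algebra_mulVr : {in algebra_unit, left_inverse 1 algebra_inv *%R}.
Proof.
move=> g /asboolP gU; rewrite /algebra_inv; case: pselect => // e.
exact: projT2 (cid e).
Qed.

Lemma algebra_unitP g h : h * g = 1 -> algebra_unit g.
Proof. by move=> hg; apply/asboolP; exists h. Qed.

Lemma algebra_inv_out : {in [predC algebra_unit], algebra_inv =1 id}.
Proof.
by move=> g /asboolP gU; rewrite /algebra_inv; case: pselect.
Qed.

End LeadingTerms.

HB.instance Definition _ S := GRing.ComNzRing_hasMulInverse.Build (algebra S)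
  (@algebra_mulVr S) (@algebra_unitP S) (@algebra_inv_out S).
HB.instance Definition _ S := GRing.ComUnitRing_isIntegral.Build (algebra S)
  (@algebra_mulf_eq0 S).

Section ConstantTerm.
Variable S : ranked_semigroup R k.
Implicit Types (g h : algebra S) (x y z : S).

(** Evaluation at [0] is a ring morphism because [0] has only the decomposition
[0 + 0]. *)
Definition constant_term g : R[i] := g (szero S).

Lemma constant_term_is_zmod_morphism : zmod_morphism constant_term.
Proof. by []. Qed.

Lemma constant_term_is_monoid_morphism : monoid_morphism constant_term.
Proof.
split=> [|g h]; first by rewrite /constant_term -[1]/(dunit S) dunitE eqxx.
have := @mul_lead S g h (szero S) (szero S); rewrite sadd0.
by apply=> y; rewrite rank0.
Qed.

HB.instance Definition _ := GRing.isZmodMorphism.Build (algebra S) R[i]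
  constant_term constant_term_is_zmod_morphism.
HB.instance Definition _ := GRing.isMonoidMorphism.Build (algebra S) R[i]
  constant_term constant_term_is_monoid_morphism.

End ConstantTerm.
End Algebra.

(** * Lifting simple zeros *)

Lemma simple_zeroP (F : fieldType) (f : {poly F}) (z : F) :
  simple_zero f z -> f.[z] = 0 /\ f^`().[z] != 0.
Proof.
rewrite /simple_zero => fz.
have f0 : f != 0.
  (* For [f = 0] the multiplicity ranges over exponents below 1, so it is 0. *)
  apply/eqP => f0; move: fz; rewrite f0 /mup.
  case: arg_maxnP => [|i _ _ i1]; first by rewrite dvdp0.
  by have := ltn_ord i; rewrite i1 size_poly0.
have : ('X - z%:P) ^+ 1 %| f by rewrite -mup_geq// fz.
rewrite expr1 => /dvdpP[q fq].
split; first by rewrite fq !hornerE subrr mulr0.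
rewrite fq derivM derivXsubC mulr1 !hornerE subrr mulr0 add0r.
apply/negP => /factor_theorem[r qr].
suff : (1 < mup z f)%N by rewrite fz.
by rewrite mup_geq// fq qr -mulrA -expr2 dvdp_mull.
Qed.

Section Roots.
Context {R : realType} {k : nat} (S : ranked_semigroup R k).
Implicit Types (g h : algebra S) (x y z : S).
Notation ct := (constant_term (S := S)).

Variables (P : {poly algebra S}) (z0 : R[i]).
Let f : {poly R[i]} := map_poly ct P.

(** A first-order Taylor formula that is exact at the first place where [g] and
[h] may differ.  Write [P - P.[h] = ('X - h) * Q]; then [P.[g] - P.[h] = (g -
h) * Q.[g]], whose value at [x] only sees the constant term of [Q.[g]].
Applying evaluation at [0] to the factorization identifies that constant term
with the derivative of [f] at [z0]. *)
Lemma horner_linearize g h x : ct g = z0 -> ct h = z0 ->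
  (forall y, (rank y < rank x)%N -> g y = h y) ->
  P.[g] x - P.[h] x = (g x - h x) * f^`().[z0].
Proof.
move=> gz hz gh.
have /factor_theorem[Q PQ] : root (P - P.[h]%:P) h.
  by rewrite rootE !hornerE subrr.
have fQ : f^`().[z0] = ct Q.[g].
  have -> : f^`() = (map_poly ct (P - P.[h]%:P))^`().
    by rewrite rmorphB /= map_polyC /= derivB derivC subr0.
  rewrite PQ rmorphM /= rmorphB /= map_polyX map_polyC /= hz derivM derivXsubC.
  by rewrite mulr1 !hornerE subrr mulr0 add0r -gz horner_map.
have <- : (P.[g] - P.[h]) x = P.[g] x - P.[h] x by [].
have -> : P.[g] - P.[h] = (g - h) * Q.[g].
  by have := congr1 (horner^~ g) PQ; rewrite !hornerE mulrC.
rewrite -{1}[x]sadd0 mul_lead.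
- by rewrite fQ.
- by move=> y /gh yx; rewrite -[LHS]/(g y - h y) yx subrr.
- by move=> y; rewrite rank0.
Qed.

Hypotheses (f0 : f.[z0] = 0) (f'0 : f^`().[z0] != 0).

(** At the first place where [g] and [h] could differ, [horner_linearize] makes
their difference a multiple of [P.[g] - P.[h]]. *)
Lemma approx_root_unique n g h : ct g = z0 -> ct h = z0 ->
  (forall y, (rank y <= n)%N -> P.[g] y = P.[h] y) ->
  forall y, (rank y <= n)%N -> g y = h y.
Proof.
move=> gz hz PP y; move: {2}(rank y) (leqnn (rank y)) => m.
elim/ltn_ind: m y => m IH y ym yn.
have /esym/eqP : P.[g] y - P.[h] y = (g y - h y) * f^`().[z0].
  apply: horner_linearize => // z zy.
  by apply: (IH (rank z)) => //; rewrite ?(leq_trans zy)// ltnW ?(leq_trans zy).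
by rewrite PP// subrr mulf_eq0 (negPf f'0) orbF subr_eq0 => /eqP.
Qed.

Definition monomial x (c : R[i]) : algebra S := fun y => c *+ (y == x).

(** Induction on [n]: at most one element has rank [n.+1], and changing [g]
there alters [P.[g]] by a nonzero multiple of the change and leaves the lower
values alone, so one division corrects the error. *)
Lemma approx_root_exists n :
  exists g, ct g = z0 /\ forall y, (rank y <= n)%N -> P.[g] y = 0.
Proof.
elim: n => [|n [g [gz gn]]].
  exists (monomial (szero S) z0); split.
    by rewrite /constant_term /monomial eqxx.
  move=> y; rewrite leqn0 => /eqP y0.
  have -> : y = szero S by apply: rank_inj; rewrite y0 rank0.
  rewrite -[LHS]/(ct _) -horner_map /= -/f.
  by rewrite [ct _]/(z0 *+ (szero S == szero S)) eqxx.
have [[x xn]|nx] := pselect (exists x : S, rank x = n.+1); last first.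
  exists g; split=> // y; rewrite leq_eqVlt => /predU1P[yn|/gn//].
  by case: nx; exists y.
(* The solution of [P.[g] x + c * f'(z0) = 0]. *)
pose c := - P.[g] x / f^`().[z0].
have x0 : x != szero S by apply/eqP => x0; move: xn; rewrite x0 rank0.
have gcz : ct (g + monomial x c) = z0.
  rewrite rmorphD /= gz [ct (monomial _ _)]/(c *+ (szero S == x)).
  by rewrite eq_sym (negPf x0) addr0.
have lin y : (rank y <= n.+1)%N ->
    P.[g + monomial x c] y - P.[g] y = c * f^`().[z0] *+ (y == x).
  move=> yn; rewrite (horner_linearize gcz gz).
    rewrite -[(g + _) y]/(g y + c *+ (y == x)) addrC addKr.
    by rewrite mulrnAl.
  move=> z zy; rewrite -[LHS]/(g z + c *+ (z == x)).
  case: eqP => [zx|_]; last by rewrite addr0.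
  by move: zy; rewrite zx xn ltnNge yn.
exists (g + monomial x c); split=> // y yn.
have /eqP := lin y yn; rewrite subr_eq => /eqP ->.
have [->|yx] := eqVneq y x; first by rewrite divfK// addNr.
rewrite add0r gn// -ltnS ltn_neqAle yn andbT.
by apply: contra_neq yx => yE; apply: rank_inj; rewrite yE.
Qed.

(** The approximate roots agree on common initial segments, so their diagonal
is a root: its value at [x] is that of the approximation up to the rank of [x].
*)
Lemma simple_root_lift : exists! g, P.[g] = 0 /\ ct g = z0.
Proof.
have /choice[G GP] := approx_root_exists.
have Gz n : ct (G n) = z0 by case: (GP n).
have G0 n y : (rank y <= n)%N -> P.[G n] y = 0 by case: (GP n) => _; apply.
pose g : algebra S := fun x => G (rank x) x.
have gG n y : (rank y <= n)%N -> g y = G n y.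
  move=> yn; apply: (approx_root_unique (n := rank y) (Gz _) (Gz n)) => // z zy.
  by rewrite !G0// (leq_trans zy).
have gz : ct g = z0 by rewrite -(Gz (rank (szero S))).
exists g; split.
  split=> //; apply/funext => x; apply/eqP.
  rewrite -[_ x]subr0 -[X in _ - X](G0 _ _ (leqnn (rank x))).
  rewrite (horner_linearize gz (Gz (rank x))).
    by rewrite (gG (rank x))// subrr mul0r.
  by move=> y /ltnW yx; exact: gG.
move=> h [Ph hz]; apply/funext => x.
apply: (approx_root_unique (n := rank x) (Gz _) hz) => // y yx.
by rewrite Ph G0.
Qed.

End Roots.

(** * Dirichlet polynomials as polynomials over the algebra *)

Section DirichletPolynomials.
Context {R : realType} {k : nat} (S : ranked_semigroup R k).
Implicit Types (g : algebra S) (d : nat).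

(** Over the ring [algebra S], solutions of [Tg = 0] are roots of this
polynomial, and [poly_at0] is its image under the constant term. *)
Definition poly_of d (a : 'I_d.+1 -> dirichlet S) : {poly algebra S} :=
  \poly_(j < d.+1) (a (inord j) : algebra S).

Lemma dpowE g j : dpow g j = g ^+ j.
Proof. by elim: j => [//|j IH]; rewrite exprS -IH. Qed.

Lemma dpolyE d (a : 'I_d.+1 -> dirichlet S) g :
  dpoly a g = (poly_of a).[g].
Proof.
rewrite horner_poly; apply/funext => x; rewrite /dpoly.
rewrite (big_morph (fun h : algebra S => h x) (id1 := 0) (op1 := +%R))//.
by apply: eq_bigr => j _; rewrite dpowE inord_val.
Qed.

Lemma poly_at0E d (a : 'I_d.+1 -> dirichlet S) :
  poly_at0 (carrier0 S) a = map_poly (@constant_term _ _ S) (poly_of a).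
Proof.
rewrite /poly_of poly_def rmorph_sum /= /poly_at0; apply: eq_bigr => j _.
by rewrite -mul_polyC rmorphM /= map_polyC map_polyXn /= inord_val mul_polyC.
Qed.

Lemma poly_of_neq0 d (a : 'I_d.+1 -> dirichlet S) :
  a ord_max <> dzero S -> poly_of a != 0.
Proof.
move=> ad; apply/eqP => /(congr1 (fun p : {poly algebra S} => p`_d)).
rewrite coef0 coef_poly ltnSn => ad0; apply: ad; rewrite -[RHS]ad0.
by congr a; apply: val_inj; rewrite /= inordK.
Qed.

Lemma poly_of_coef d (P : {poly algebra S}) :
  (size P <= d.+1)%N -> poly_of (fun j : 'I_d.+1 => P`_j) = P.
Proof.
move=> Pd; apply/polyP => j; rewrite coef_poly; case: ltnP => [jd|dj].
  by rewrite inordK.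
by rewrite nth_default// (leq_trans Pd).
Qed.

Lemma card_roots_le (P : {poly algebra S}) d : P != 0 -> (size P <= d.+1)%N ->
  [set g | P.[g] = 0] #<= `I_d.
Proof.
move=> P0 Pd.
have bound (s : seq (algebra S)) :
    uniq s -> [set` s] `<=` [set g | P.[g] = 0] -> (size s <= d)%N.
  move=> us sP; rewrite -ltnS (leq_trans _ Pd)// max_poly_roots//.
  by apply/allP => g /sP /= Pg; rewrite rootE Pg.
have [fin|inf] := pselect (finite_set [set g : algebra S | P.[g] = 0]).
  have [n nP] := fin; rewrite (card_le_eql nP) card_le_II -(card_fset_set nP).
  by apply: bound; rewrite ?fset_uniq// fset_setK.
have [B BP dB] := infinite_set_fset d.+1 inf.
by have := leq_trans dB (bound _ (fset_uniq B) BP); rewrite ltnn.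
Qed.

End DirichletPolynomials.

(** * A quadratic equation without solution *)

Section Square.
Context {R : realType} {k : nat} (S : ranked_semigroup R k).

(** The constant term of a square root of the indicator of [e] vanishes, since
its square does; but [0] is the only element below [e], so [g] vanishes below
[e] and the value of [g ^+ 2] at [e] is [g e * g 0 = 0]. *)
Lemma square_indecomposable_nosol (e : S) : e != szero S ->
  (forall x : S, (rank x < rank e)%N -> x = szero S) ->
  forall g, g ^+ 2 <> monomial e 1.
Proof.
move=> e0 emin g ge.
have ge2 : (g ^+ 2) e = 1 by rewrite ge /monomial eqxx.
have g0 : g (szero S) = 0.
  apply/eqP; rewrite -sqrf_eq0 -[g _]/(constant_term g) -rmorphXn /= ge.
  by rewrite /constant_term /monomial [szero S == e]eq_sym (negPf e0).
have : (g ^+ 2) e = g e * g (szero S).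
  rewrite -{1}[e]sadd0 expr2 mul_lead//; first by move=> y /emin ->.
  by move=> y; rewrite rank0.
by rewrite ge2 g0 mulr0 => /eqP; rewrite oner_eq0.
Qed.

Lemma nonzero_min_rank :
  infinite_set (S : set 'rV[R]_k) ->
  exists2 e : S, e != szero S &
    forall x : S, (rank x < rank e)%N -> x = szero S.
Proof.
move=> Sinf.
have /ex_minnP[n /asboolP[e en e0] nmin] :
    exists n, `[< exists2 e : S, rank e = n & e != szero S >].
  apply: contrapT => none; apply: Sinf.
  apply: (sub_finite_set _ (finite_set1 0)) => x Sx.
  apply: contrapT => x0; apply: none; exists (rank (exist _ x (mem_set Sx))).
  by apply/asboolP; exists (exist _ x (mem_set Sx)) => //; apply/eqP => -[].
exists e => // x xe; apply: contrapT => /eqP x0.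
by move: xe; rewrite en ltnNge nmin//; apply/asboolP; exists x.
Qed.

End Square.

(** * The rank of a discrete semigroup in the nonnegative orthant *)

(** The sets containing all but finitely many points of [A] form a proper
filter, and a cluster point of it is a limit point of [A]: removing that point
from [A] still leaves a set of the filter. *)
Lemma compact_infinite_limit_point (T : topologicalType) (K A : set T) :
  compact K -> A `<=` K -> infinite_set A -> limit_point A !=set0.
Proof.
move=> cK AK infA.
pose F : set_system T := [set B | finite_set (A `\` B)].
have FF : ProperFilter F.
  split; first by rewrite /F /= setD0.
  split; rewrite /F /=; first by rewrite setDT.
  - by move=> B C fB fC; rewrite /= setDIr finite_setU.
  - by move=> B C BC; apply: sub_finite_set; exact: setDS.
have [|p [_ Fp]] := cK F.
  by rewrite /F /= (_ : A `\` K = set0)// setD_eq0.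
exists p => U Up.
have [|y [[Ay yp] Uy]] := Fp (A `\ p) U _ Up; last first.
  by exists y; split=> //; apply/eqP.
rewrite /F /= setDD; apply: sub_finite_set (@subIsetr _ A [set p]) _.
exact: finite_set1.
Qed.

Section LeadingCoefficientOrder.
Context {R : realType} {k : nat}.
Implicit Types v w x y z : 'rV[R]_k.

Definition weight v : R := \sum_i v ord0 i.

(** Comparing vectors by the leading coefficient of the difference of these
polynomials compares coordinate sums first (coefficient of degree [k]) and then
the coordinates lexicographically from the last one down; invariance under
translations is then additivity of [order_poly]. *)
Definition order_poly v : {poly R} := rVpoly v + weight v *: 'X^k.

Definition precedes v w : Prop := 0 < lead_coef (order_poly (w - v)).

Lemma weightD v w : weight (v + w) = weight v + weight w.
Proof. by rewrite /weight -big_split; apply: eq_bigr => i _; rewrite mxE. Qed.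

Lemma order_polyD v w : order_poly (v + w) = order_poly v + order_poly w.
Proof. by rewrite /order_poly linearD weightD scalerDl addrACA. Qed.

Lemma order_poly0 : order_poly 0 = 0.
Proof. by apply: (addrI (order_poly 0)); rewrite -order_polyD !addr0. Qed.

Lemma order_polyN v : order_poly (- v) = - order_poly v.
Proof.
by apply: (addrI (order_poly v)); rewrite -order_polyD !subrr order_poly0.
Qed.

Lemma order_poly_eq0 v : order_poly v = 0 -> v = 0.
Proof.
move=> v0; apply/rowP => i; rewrite mxE.
have := congr1 (fun p : {poly R} => p`_i) v0.
by rewrite coef0 coefD coefZ coefXn ltn_eqF// mulr0 addr0 coef_rVpoly_ord.
Qed.

(** The coordinate sum is the coefficient of the highest possible degree:
either it is the leading coefficient or it vanishes. *)
Lemma precedes_weight v w : precedes v w -> weight v <= weight w.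
Proof.
rewrite /precedes => vw; rewrite -subr_ge0.
have -> : weight w - weight v = (order_poly (w - v))`_k.
  rewrite coefD coefZ coefXn eqxx mulr1 nth_default ?size_poly// add0r.
  by apply/eqP; rewrite subr_eq -weightD subrK.
have [/eqP k_top|k_top] := boolP ((size (order_poly (w - v))).-1 == k).
  by rewrite -[in X in _`_X]k_top -lead_coefE ltW.
rewrite nth_default//.
suff : (size (order_poly (w - v)) <= k.+1)%N.
  by move: k_top; case: (size _) => //= n nk; rewrite ltnS ltn_neqAle nk.
rewrite (leq_trans (size_polyD _ _))// geq_max (leqW (size_poly _ _)).
by rewrite (leq_trans (size_scale_leq _ _))// size_polyXn.
Qed.

Lemma precedes_irr v : ~ precedes v v.
Proof. by rewrite /precedes subrr order_poly0 lead_coef0 ltxx. Qed.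

Lemma lead_coef_gt0D (p q : {poly R}) :
  0 < lead_coef p -> 0 < lead_coef q -> 0 < lead_coef (p + q).
Proof.
move=> p0 q0; have [pq|qp|pq] := ltngtP (size p) (size q).
- by rewrite lead_coefDr.
- by rewrite lead_coefDl.
- have pqE : (p + q)`_(size p).-1 = lead_coef p + lead_coef q.
    by rewrite coefD !lead_coefE pq.
  suff -> : lead_coef (p + q) = lead_coef p + lead_coef q by rewrite addr_gt0.
  rewrite -pqE lead_coefE; congr _`_ _.-1; apply/eqP; rewrite eqn_leq.
  rewrite (leq_trans (size_polyD _ _)) ?geq_max ?pq ?leqnn//=.
  rewrite -pq -[leqLHS]prednK; last first.
    rewrite size_poly_gt0; apply: contraTneq p0 => ->.
    by rewrite lead_coef0 ltxx.
  rewrite ltnNge; apply/negP => /leq_sizeP /(_ _ (leqnn _)) /eqP.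
  by rewrite pqE gt_eqF// addr_gt0.
Qed.

Lemma precedes_trans v w x : precedes v w -> precedes w x -> precedes v x.
Proof.
rewrite /precedes => vw wx; rewrite -(subrK w x) -addrA order_polyD.
exact: lead_coef_gt0D.
Qed.

Lemma precedesD2l x v w : precedes v w -> precedes (x + v) (x + w).
Proof. by rewrite /precedes opprD addrACA subrr add0r. Qed.

Lemma precedes_total v w : v <> w -> precedes v w \/ precedes w v.
Proof.
move=> vw; rewrite /precedes -(opprB w v) order_polyN lead_coefN oppr_gt0.
have : lead_coef (order_poly (w - v)) != 0.
  rewrite lead_coef_eq0; apply/eqP => /order_poly_eq0 /eqP.
  by rewrite subr_eq0 => /eqP /esym.
by rewrite neq_lt => /orP[]; [right|left].
Qed.

End LeadingCoefficientOrder.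

Section Rank.
Context {R : realType} {k : nat} (X : set 'rV[R]_k).
Hypothesis X_ge0 : forall x, X x -> forall i, 0 <= x ord0 i.
Hypothesis X0 : X 0.
Hypothesis X_discrete : limit_point X = set0.

(** Nonnegative coordinates with sum at most [c] all lie in the segment from
[0] to [c], a compact box. *)
Lemma finite_weight_le c : finite_set [set x | X x /\ weight x <= c].
Proof.
apply: contrapT => infc.
have K : compact [set v : 'rV[R]_k | forall i, `[0, c]%classic (v ord0 i)].
  apply: (@rV_compact _ _ (fun=> `[0, c]%classic)) => i.
  exact: segment_compact.
have [|p pl] := compact_infinite_limit_point K _ infc.
  move=> x /= [Xx xc] i; rewrite in_itv /= X_ge0//= (le_trans _ xc)//.
  rewrite /weight (bigD1 i)//= lerDl sumr_ge0// => j _; exact: X_ge0.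
suff : limit_point X p by rewrite X_discrete.
by move=> U /pl[y [yp [Xy _] Uy]]; exists y.
Qed.

Definition below (x : X) : set X := [set y | precedes (val y) (val x)].

Lemma finite_below x : finite_set (below x).
Proof.
apply: (@sub_finite_set _ _
    (val @^-1` [set w | X w /\ weight w <= weight (val x)])).
  by move=> y yx; split; [exact: set_valP|exact: precedes_weight].
by apply: finite_preimage (finite_weight_le _) => y z _ _; exact: val_inj.
Qed.

Definition position (x : X) : nat := #|` fset_set (below x)|%fset.

Lemma position_lt x y : precedes (val x) (val y) -> (position x < position y)%N.
Proof.
move=> xy.
have mem z w : (z \in fset_set (below w)) = `[< precedes (val z) (val w) >].
  by rewrite in_fset_set; [rewrite /below unfold_in|exact: finite_below].
apply: fproper_ltn_card; rewrite fproperE; apply/andP; split.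
  apply/fsubsetP => z; rewrite !mem => /asboolP zx.
  by apply/asboolP/(precedes_trans zx).
apply/negP => /fsubsetP /(_ x); rewrite !mem => /(_ (introT (asboolP _) xy)).
by move/asboolP; exact: precedes_irr.
Qed.

Lemma position_ltP x y :
  (position x < position y)%N -> precedes (val x) (val y).
Proof.
move=> pxy.
have [xy|/precedes_total[//|/position_lt yx]] := pselect (val x = val y).
  by move: pxy; rewrite (val_inj xy) ltnn.
by move: pxy; rewrite ltnNge ltnW.
Qed.

Lemma position_inj : injective position.
Proof.
move=> x y pxy; apply: val_inj; apply: contrapT.
by move=> /precedes_total[] /position_lt; rewrite pxy ltnn.
Qed.

Lemma position_ltD2l (x y z u v : X) :
  val u = val x + val y -> val v = val x + val z ->
  (position y < position z)%N -> (position u < position v)%N.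
Proof.
move=> uE vE /position_ltP yz; apply: position_lt; rewrite uE vE.
exact: precedesD2l.
Qed.

(** [0] has the least coordinate sum, and no other element shares it, since
coordinates are nonnegative. *)
Lemma position0 :
  position (exist (fun w => w \in X) 0 (mem_set X0)) = 0%N.
Proof.
set o : X := exist _ _ _.
suff b0 : below o = set0 by rewrite /position b0 fset_set0 cardfs0.
apply/seteqP; split=> // y; rewrite /below /= => y0.
have wy : weight (val y) = 0.
  apply/eqP; rewrite eq_le sumr_ge0 ?andbT; last first.
    by move=> i _; exact/X_ge0/set_valP.
  rewrite (le_trans (precedes_weight y0))// /weight big1// => i _.
  by rewrite mxE.
have yz : val y = 0.
  apply/rowP => i; rewrite mxE; apply/eqP.
  move/eqP: wy; rewrite psumr_eq0 => [/allP/(_ i)|j _].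
    by rewrite mem_index_enum; exact.
  exact/X_ge0/set_valP.
by apply: (@precedes_irr _ _ (0 : 'rV[R]_k)); rewrite -{1}yz.
Qed.

End Rank.

(** * The theorem *)

Theorem theorem1 (R : realType) (k : nat) (k_gt0 : (0 < k)%N)
    (X : set 'rV[R]_k)
    (X_ge0 : forall x, X x -> forall i, 0 <= x ord0 i)
    (X_add : forall x y, X x -> X y -> X (x + y))
    (X0 : X 0)
    (X_infinite : infinite_set X)
    (X_discrete : limit_point X = set0) :
  [/\ (* (i) *)
      forall (d : nat) (a : 'I_d.+1 -> dirichlet X),
        (0 < d)%N -> a ord_max <> dzero X ->
        forall z0 : R[i], simple_zero (poly_at0 X0 a) z0 ->
        exists! g : dirichlet X, dpoly a g = dzero X /\ at0 X0 g = z0,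
      (* (ii) *)
      exists (d : nat) (a : 'I_d.+1 -> dirichlet X),
        [/\ (0 < d)%N, a ord_max <> dzero X,
            forall z : R[i], ~ simple_zero (poly_at0 X0 a) z
          & forall g : dirichlet X, dpoly a g <> dzero X]
    & (* (iii) *)
      forall (d : nat) (a : 'I_d.+1 -> dirichlet X),
        (0 < d)%N -> a ord_max <> dzero X ->
        [set g : dirichlet X | dpoly a g = dzero X] #<= `I_d ].
Proof.
pose S := RankedSemigroup X_add (position_inj X_ge0 X_discrete)
  (position0 X_ge0 X0) (position_ltD2l X_ge0 X_discrete).
split.
- move=> d a _ _ z0; rewrite (@poly_at0E _ _ S d a) => /simple_zeroP[f0 f'0].
  have [g [[Pg gz] guniq]] := simple_root_lift f0 f'0.
  exists g; split; first by rewrite (@dpolyE _ _ S d a).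
  by move=> h [Ph hz]; apply: guniq; rewrite -dpolyE.
- have [e e0 emin] := @nonzero_min_rank _ _ S X_infinite.
  pose P : {poly algebra S} := 'X^2 - (monomial e 1)%:P.
  have sP : size P = 3%N by rewrite size_XnsubC.
  exists 2%N, (fun j : 'I_3 => P`_j); split=> //.
  + rewrite /= coefB coefXn coefC subr0 => P2.
    by have /eqP := oner_neq0 (algebra S).
  + move=> z; rewrite (@poly_at0E _ _ S 2) poly_of_coef ?sP// => /simple_zeroP.
    rewrite rmorphB /= map_polyXn map_polyC /=.
    rewrite [constant_term _]/(1 *+ (szero S == e)) eq_sym (negPf e0) subr0.
    rewrite derivXn !hornerE => -[/eqP].
    by rewrite sqrf_eq0 => /eqP ->; rewrite addr0 eqxx.
  + move=> g; rewrite (@dpolyE _ _ S 2) poly_of_coef ?sP//.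
    rewrite hornerD hornerN hornerXn hornerC.
    move=> /(@subr0_eq (algebra S)).
    exact: (square_indecomposable_nosol e0 emin).
- move=> d a _ ad.
  suff -> : [set g | dpoly a g = dzero X] =
      [set g : algebra S | (@poly_of _ _ S d a).[g] = 0].
    exact: card_roots_le (poly_of_neq0 (S := S) ad) (size_poly _ _).
  by apply/seteqP; split=> g /=; rewrite (@dpolyE _ _ S d a).
Qed.
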